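(* A single soft-threshold search on a graph with $n$ vertices and $m$ arcs terminates after at most $n^2+m+n$ iterations of its while loop.
   Context: Soft-threshold search is triggered when an arc $(v,w)$ with $v>w$ is added to an acyclic graph with topological order $<$ (comparisons use the order before the addition). Each vertex $x$ has a list of outgoing arcs and a list of incoming arcs. Initialize $F=\{w\}$, $B=\{v\}$, $\mathit{out}(w)=$ first arc on $w$'s outgoing list, $\mathit{in}(v)=$ first arc on $v$'s incoming list (null if none), $s=v$; $F_A=\{w\}$ if $\mathit{out}(w)\neq$ null else $\{\}$, $F_P=\{\}$; $B_A=\{v\}$ if $\mathit{in}(v)\ne$ null else $\{\}$, $B_P=\{\}$. While $F_A\ne\{\}$ and $B_A\ne\{\}$: choose any $u\in F_A$, $z\in B_A$. If $u<z$, do a search step: let $(u,x)=\mathit{out}(u)$, $(y,z)=\mathit{in}(z)$; advance $\mathit{out}(u)$ and $\mathit{in}(z)$ to the next arcs on the respective lists (null if none); if $\mathit{out}(u)$ is null remove $u$ from $F_A$; if $\mathit{in}(z)$ is null remove $z$ from $B_A$; if $x\in B$ return $(u,x)$ (cycle); else if $y\in F$ return $(y,z)$ (cycle); if $x\notin F$, add $x$ to $F$, set $\mathit{out}(x)$ to the first outgoing arc of $x$ and add $x$ to $F_A$ if it is non-null; if $y\notin B$, add $y$ to $B$, set $\mathit{in}(y)$ to the first incoming arc of $y$ and add $y$ to $B_A$ if non-null. Otherwise ($u>z$): if $u>s$ move $u$ from $F_A$ to $F_P$; if $z<s$ move $z$ from $B_A$ to $B_P$. Then, if $F_A=\{\}$: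 set $B_P=\{\}$, remove $s$ from $B_A$, and if $F_P\ne\{\}$ choose a new $s\in F_P$ and move all $x\in F_P$ with $x\le s$ to $F_A$. If $B_A=\{\}$: set $F_P=\{\}$, remove $s$ from $F_A$, and if $B_P\ne\{\}$ choose a new $s\in B_P$ and move all $x\in B_P$ with $x\ge s$ to $B_A$. When the loop ends, return null.
   Formalization: The search as described leaves the case u = z undefined (a vertex can enter both F and B; treating it as ''otherwise'' can loop forever). Iterations with u = z are excluded: the bound covers runs with u < z or u > z, and progress is claimed only for u ≠ z. *)

(* Defs.v *)
From HB Require Import structures.
From mathcomp Require Import all_boot all_order.

Set Implicit Arguments.
Unset Strict Implicit.
Unset Printing Implicit Defensive.

Import Order.TTheory.

(* Vertices form a [finOrderType], whose order is the topological order before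
   the addition of the new arc; arcs are ordered pairs (tail, head). *)

(* The existence of such a (strict total) order makes the graph acyclic. *)
Definition topological (d : Order.disp_t) (V : finOrderType d)
    (G : {set V * V}) : Prop :=
  forall x y : V, (x, y) \in G -> (x < y)%O.

Definition out_lists (V : finType) (G : {set V * V})
    (outl : V -> seq (V * V)) : Prop :=
  forall x, uniq (outl x) /\ outl x =i [set a in G | a.1 == x].

Definition in_lists (V : finType) (G : {set V * V})
    (inl : V -> seq (V * V)) : Prop :=
  forall x, uniq (inl x) /\ inl x =i [set a in G | a.2 == x].

(* A pointer into an arc list is the suffix of the list starting at the arc
   pointed to; the null pointer is [::]. *)
Record state (V : finType) := State {
  fwd : {set V};          (* F *)
  bwd : {set V};          (* B *)
  fwdA : {set V};         (* F_A *)
  fwdP : {set V};         (* F_P *)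
  bwdA : {set V};         (* B_A *)
  bwdP : {set V};         (* B_P *)
  outp : V -> seq (V * V);
  inp : V -> seq (V * V);
  thr : V                 (* s *)
}.

Inductive outcome (V : finType) :=
  | Continue of state V
  | Return of V * V.      (* a cycle was found through this arc *)

(* {x} if the pointer p is not null, and {} otherwise *)
Definition if_live (V : finType) (p : seq (V * V)) (x : V) : {set V} :=
  if p is [::] then set0 else [set x].

(* Pointers of vertices that have not been reached are irrelevant, and are
   null here. *)
Definition init (V : finType) (outl inl : V -> seq (V * V)) (v w : V) :
    state V :=
  {| fwd := [set w]; bwd := [set v];
     fwdA := if_live (outl w) w; fwdP := set0;
     bwdA := if_live (inl v) v; bwdP := set0;
     outp := [fun _ => [::] with w |-> outl w];
     inp := [fun _ => [::] with v |-> inl v];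
     thr := v |}.

(* [advance] moves out(u) and in(z) to ro and ri. *)
Definition advance (V : finType) (st : state V) (u z : V)
    (ro ri : seq (V * V)) : state V :=
  {| fwd := fwd st; bwd := bwd st;
     fwdA := if ro is [::] then fwdA st :\ u else fwdA st; fwdP := fwdP st;
     bwdA := if ri is [::] then bwdA st :\ z else bwdA st; bwdP := bwdP st;
     outp := [eta outp st with u |-> ro];
     inp := [eta inp st with z |-> ri];
     thr := thr st |}.

Definition add_fwd (V : finType) (outl : V -> seq (V * V)) (st : state V)
    (x : V) : state V :=
  if x \in fwd st then st else
  {| fwd := x |: fwd st; bwd := bwd st;
     fwdA := if_live (outl x) x :|: fwdA st; fwdP := fwdP st;
     bwdA := bwdA st; bwdP := bwdP st;
     outp := [eta outp st with x |-> outl x]; inp := inp st;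
     thr := thr st |}.

Definition add_bwd (V : finType) (inl : V -> seq (V * V)) (st : state V)
    (y : V) : state V :=
  if y \in bwd st then st else
  {| fwd := fwd st; bwd := y |: bwd st;
     fwdA := fwdA st; fwdP := fwdP st;
     bwdA := if_live (inl y) y :|: bwdA st; bwdP := bwdP st;
     outp := outp st; inp := [eta inp st with y |-> inl y];
     thr := thr st |}.

(* Both tests precede both additions, so a vertex x = y reached simultaneously
   from both sides is put in F and in B. *)
Inductive search_step (V : finType) (outl inl : V -> seq (V * V))
    (st : state V) (u z : V) : outcome V -> Prop :=
  | Step_return_out x y ro ri of
      outp st u = (u, x) :: ro & inp st z = (y, z) :: ri &
      x \in bwd st :
      search_step outl inl st u z (Return (u, x))
  | Step_return_in x y ro ri of
      outp st u = (u, x) :: ro & inp st z = (y, z) :: ri &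
      x \notin bwd st & y \in fwd st :
      search_step outl inl st u z (Return (y, z))
  | Step_add x y ro ri of
      outp st u = (u, x) :: ro & inp st z = (y, z) :: ri &
      x \notin bwd st & y \notin fwd st :
      search_step outl inl st u z
        (Continue (add_bwd inl (add_fwd outl (advance st u z ro ri) x) y)).

Definition make_passive (d : Order.disp_t) (V : finOrderType d) (st : state V)
    (u z : V) : state V :=
  {| fwd := fwd st; bwd := bwd st;
     fwdA := if (thr st < u)%O then fwdA st :\ u else fwdA st;
     fwdP := if (thr st < u)%O then u |: fwdP st else fwdP st;
     bwdA := if (z < thr st)%O then bwdA st :\ z else bwdA st;
     bwdP := if (z < thr st)%O then z |: bwdP st else bwdP st;
     outp := outp st; inp := inp st;
     thr := thr st |}.

Definition kill_bwd (V : finType) (st : state V) : state V :=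
  {| fwd := fwd st; bwd := bwd st;
     fwdA := fwdA st; fwdP := fwdP st;
     bwdA := bwdA st :\ thr st; bwdP := set0;
     outp := outp st; inp := inp st; thr := thr st |}.

Definition kill_fwd (V : finType) (st : state V) : state V :=
  {| fwd := fwd st; bwd := bwd st;
     fwdA := fwdA st :\ thr st; fwdP := set0;
     bwdA := bwdA st; bwdP := bwdP st;
     outp := outp st; inp := inp st; thr := thr st |}.

Definition new_thr_fwd (d : Order.disp_t) (V : finOrderType d) (st : state V)
    (s : V) : state V :=
  let X := [set x in fwdP st | (x <= s)%O] in
  {| fwd := fwd st; bwd := bwd st;
     fwdA := fwdA st :|: X; fwdP := fwdP st :\: X;
     bwdA := bwdA st; bwdP := bwdP st;
     outp := outp st; inp := inp st; thr := s |}.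

Definition new_thr_bwd (d : Order.disp_t) (V : finOrderType d) (st : state V)
    (s : V) : state V :=
  let X := [set x in bwdP st | (s <= x)%O] in
  {| fwd := fwd st; bwd := bwd st;
     fwdA := fwdA st; fwdP := fwdP st;
     bwdA := bwdA st :|: X; bwdP := bwdP st :\: X;
     outp := outp st; inp := inp st; thr := s |}.

(* "If F_A = {} ..." *)
Inductive update_fwd (d : Order.disp_t) (V : finOrderType d) (st : state V) :
    state V -> Prop :=
  | Fwd_skip of fwdA st != set0 : update_fwd st st
  | Fwd_stop of fwdA st == set0 & fwdP st == set0 :
      update_fwd st (kill_bwd st)
  | Fwd_next s of fwdA st == set0 & s \in fwdP st :
      update_fwd st (new_thr_fwd (kill_bwd st) s).

(* "If B_A = {} ..." *)
Inductive update_bwd (d : Order.disp_t) (V : finOrderType d) (st : state V) :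
    state V -> Prop :=
  | Bwd_skip of bwdA st != set0 : update_bwd st st
  | Bwd_stop of bwdA st == set0 & bwdP st == set0 :
      update_bwd st (kill_fwd st)
  | Bwd_next s of bwdA st == set0 & s \in bwdP st :
      update_bwd st (new_thr_bwd (kill_fwd st) s).

Inductive update (d : Order.disp_t) (V : finOrderType d) :
    outcome V -> outcome V -> Prop :=
  | Update_return a : update (Return a) (Return a)
  | Update_continue st st1 st2 of update_fwd st st1 & update_bwd st1 st2 :
      update (Continue st) (Continue st2).

(* The case u = z, possible only if a vertex is in both F and B, has no rule: the
   algorithm specifies u < z and u > z only.  Were it treated as u > z, the loop
   would not terminate: u = z = s changes nothing. *)
Inductive branch (d : Order.disp_t) (V : finOrderType d)
    (outl inl : V -> seq (V * V)) (st : state V) (u z : V) :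
    outcome V -> Prop :=
  | Branch_lt o of (u < z)%O & search_step outl inl st u z o :
      branch outl inl st u z o
  | Branch_gt of (z < u)%O :
      branch outl inl st u z (Continue (make_passive st u z)).

(* One iteration of the while loop, in which u and z are chosen.  The loop exits
   (returning null) in the states where F_A or B_A is empty.  The updates follow
   both branches: a search step may also empty F_A or B_A. *)
Definition iteration (d : Order.disp_t) (V : finOrderType d)
    (outl inl : V -> seq (V * V)) (st : state V) (u z : V) (o : outcome V) :
    Prop :=
  [/\ u \in fwdA st, z \in bwdA st &
      exists2 o', branch outl inl st u z o' & update o' o].

(* [run outl inl v w k o]: some sequence of choices leads from the initial state
   to o in exactly k iterations. *)
Inductive run (d : Order.disp_t) (V : finOrderType d)
    (outl inl : V -> seq (V * V)) (v w : V) : nat -> outcome V -> Prop :=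
  | Run0 : run outl inl v w 0 (Continue (init outl inl v w))
  | RunS k st u z o of
      run outl inl v w k (Continue st) & iteration outl inl st u z o :
      run outl inl v w k.+1 o.

(* Main.v *)
(* Call a vertex live if it is in one of F_A, F_P, B_A, B_P, and dead if it has
   been reached but is not live; a dead vertex stays dead.  When s is replaced,
   the old s dies and the new s is live, so s takes at most n values.
   While s is fixed, F_P contains only vertices above s and B_P only vertices
   below s, and passive vertices stay passive, so each vertex other than s
   becomes passive at most once.  An iteration with z < u has s < u or z < s,
   hence makes some vertex passive, whereas a search step consumes an arc of an
   outgoing list.  These counts are combined in a potential that decreases in
   every iteration, unless the iteration empties F_A or B_A for good. *)
Require Import Defs.
From HB Require Import structures.
From mathcomp Require Import all_boot all_order.

Set Implicit Arguments.
Unset Strict Implicit.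
Unset Printing Implicit Defensive.

Import Order.TTheory.

(** * Invariants of one direction of the search *)

Section OneSide.
Variables (V : finType) (key : V * V -> V).

(** Stated once for both directions: [key] selects the tail for outgoing arcs and the head for
    incoming ones, and [far] is the strict side of the threshold where passive vertices of that
    direction lie. *)
Record side_inv (F A P : {set V}) (ptr : V -> seq (V * V)) (far : pred V) :
    Prop := SideInv {
  side_act : A \subset F;
  side_pass : P \subset F;
  side_disj : forall x, x \in A -> x \notin P;
  side_far : forall x, x \in P -> far x;
  side_live : forall x, x \in A :|: P -> ptr x != [::];
  side_key : forall x a, a \in ptr x -> key a = x
}.

Lemma in_if_live (p : seq (V * V)) (x y : V) :
  (y \in if_live p x) = (p != [::]) && (y == x).
Proof. by case: p => [|a p]; rewrite !inE. Qed.

Lemma side_init (l : V -> seq (V * V)) (far : pred V) (w : V) :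
  (forall x a, a \in l x -> key a = x) ->
  side_inv [set w] (if_live (l w) w) set0 [fun _ => [::] with w |-> l w] far.
Proof.
move=> keyl; split=> [|||x|x|x a] /=.
- by apply/subsetP=> x; rewrite in_if_live inE => /andP[].
- exact: sub0set.
- by move=> x _; rewrite inE.
- by rewrite inE.
- by rewrite setU0 in_if_live => /andP[? ->].
- by case: eqP => [-> /keyl|].
Qed.

Lemma side_add (F A P : {set V}) ptr far (l : V -> seq (V * V)) x :
  (forall x a, a \in l x -> key a = x) ->
  x \notin F -> side_inv F A P ptr far ->
  side_inv (x |: F) (if_live (l x) x :|: A) P [eta ptr with x |-> l x] far.
Proof.
move=> keyl xF [AF PF AP Pfar live keyp].
have xP : x \notin P by apply: contra xF; apply/subsetP.
split=> [|||//|y|y a] /=.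
- apply/subsetP=> y; rewrite !inE in_if_live => /orP[/andP[_ ->] //|yA].
  by rewrite (subsetP AF) ?orbT.
- exact/(subset_trans PF)/subsetUr.
- by move=> y; rewrite inE in_if_live => /orP[/andP[_ /eqP->] //|/AP].
- rewrite -setUA inE in_if_live; have [->|_] := eqVneq y x; last by rewrite andbF /= => /live.
  rewrite andbT => /orP[//|]; rewrite inE (negPf xP) orbF => xA.
  by rewrite (subsetP AF _ xA) in xF.
- by case: eqP => [-> /keyl|_ /keyp].
Qed.

Lemma side_advance (F A P : {set V}) ptr far u a r :
  u \in A -> ptr u = a :: r -> side_inv F A P ptr far ->
  side_inv F (if r is [::] then A :\ u else A) P [eta ptr with u |-> r] far.
Proof.
move=> uA ptru [AF PF AP Pfar live keyp].
set A' := (X in side_inv _ X).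
have A'P x : x \in A' -> (x \in A) && ((x == u) ==> (r != [::])).
  by rewrite /A'; case: (r) => [|b r']; rewrite ?inE; case: eqP => //= _ ->.
split=> [|//||//|x|x b] /=.
- by apply/subsetP=> x /A'P/andP[/(subsetP AF)].
- by move=> x /A'P/andP[/AP].
- rewrite inE => /orP[/A'P/andP[xA]|xP].
    by have [_|_] := eqVneq x u => //= _; apply: live; rewrite inE xA.
  case: (x =P u) => [xu|_]; last by apply: live; rewrite inE xP orbT.
  by move: (AP _ uA); rewrite -xu xP.
- case: eqP => [->|_ /keyp//] br.
  by apply: keyp; rewrite ptru inE br orbT.
Qed.

Lemma side_passive (F A P : {set V}) ptr (far : pred V) u :
  u \in A -> far u -> side_inv F A P ptr far ->
  side_inv F (A :\ u) (u |: P) ptr far.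
Proof.
move=> uA faru [AF PF AP Pfar live keyp]; split=> [|||x|x|//].
- exact/(subset_trans _ AF)/subsetDl.
- by rewrite subUset sub1set (subsetP AF).
- by move=> x; rewrite !inE => /andP[/negPf-> /AP].
- by rewrite !inE => /orP[/eqP->|/Pfar].
- rewrite !inE => xAP; apply: live; rewrite inE.
  by case: (x =P u) xAP => [->|_ //]; rewrite uA.
Qed.

(** With no passive vertex left, nothing ties this side to the old threshold, so [far'] is
    arbitrary. This lets the other side choose a new threshold. *)
Lemma side_kill (F A P : {set V}) ptr (far far' : pred V) s :
  side_inv F A P ptr far -> side_inv F (A :\ s) set0 ptr far'.
Proof.
move=> [AF PF AP Pfar live keyp]; split=> [|||x|x|//].
- exact/(subset_trans _ AF)/subsetDl.
- exact: sub0set.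
- by move=> x _; rewrite inE.
- by rewrite inE.
- by rewrite setU0 => /setD1P[_ xA]; apply: live; rewrite inE xA.
Qed.

(** The reactivated set [X] is exactly the part of [P] that violates [far'], so what stays passive
    is far from the new threshold. *)
Lemma side_next (F A P X : {set V}) ptr (far far' : pred V) :
  A = set0 -> X = [set x in P | ~~ far' x] -> side_inv F A P ptr far ->
  side_inv F (A :|: X) (P :\: X) ptr far'.
Proof.
move=> -> -> [AF PF AP Pfar live keyp]; split=> [|||x|x|//].
- by rewrite set0U; apply/subsetP=> x; rewrite inE => /andP[/(subsetP PF)].
- exact/(subset_trans _ PF)/subsetDl.
- by move=> x; rewrite !inE /= => /andP[-> ->].
- by rewrite !inE; case: (far' x) => //; case: (x \in P).
- rewrite !inE => xAP; apply: live; rewrite inE; apply/orP; right.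
  by case: (x \in P) xAP; rewrite ?andbF.
Qed.

End OneSide.

(** * Invariants of the two-sided search *)

Section Potential.
Variables (d : Order.disp_t) (V : finOrderType d).
Variables (outl inl : V -> seq (V * V)).
Hypothesis key_outl : forall x a, a \in outl x -> a.1 = x.
Hypothesis key_inl : forall x a, a \in inl x -> a.2 = x.

(** [inv_thr] is what makes a replaced threshold dead: it has been reached, so once it is no longer
    live it cannot be a candidate again. *)
Record search_inv (st : state V) : Prop := SearchInv {
  inv_fwd : side_inv fst (fwd st) (fwdA st) (fwdP st) (outp st)
              [pred x | thr st < x]%O;
  inv_bwd : side_inv snd (bwd st) (bwdA st) (bwdP st) (inp st)
              [pred x | x < thr st]%O;
  inv_thr : thr st \in fwd st :|: bwd st
}.

Lemma init_inv v w : search_inv (init outl inl v w).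
Proof. by split; [exact: side_init | exact: side_init | rewrite !inE eqxx orbT]. Qed.

Lemma advance_inv st u z a b ro ri :
  search_inv st -> u \in fwdA st -> z \in bwdA st ->
  outp st u = a :: ro -> inp st z = b :: ri ->
  search_inv (advance st u z ro ri).
Proof.
case=> If Ib It uA zA eo ei.
by split=> //; [exact: side_advance eo If | exact: side_advance ei Ib].
Qed.

Lemma add_fwd_inv st x : search_inv st -> search_inv (add_fwd outl st x).
Proof.
case=> If Ib It; rewrite /add_fwd; case: ifPn => [//|xF].
by split=> //=; [exact: side_add | rewrite -setUA inE It orbT].
Qed.

Lemma add_bwd_inv st y : search_inv st -> search_inv (add_bwd inl st y).
Proof.
case=> If Ib It; rewrite /add_bwd; case: ifPn => [//|yB].
by split=> //=; [exact: side_add | rewrite setUCA inE It orbT].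
Qed.

Lemma make_passive_inv st u z :
  search_inv st -> u \in fwdA st -> z \in bwdA st ->
  search_inv (make_passive st u z).
Proof.
case=> If Ib It uA zA; split=> //=.
- by case: ifP => // su; apply: side_passive.
- by case: ifP => // zs; apply: side_passive.
Qed.

Lemma kill_bwd_inv st :
  search_inv st -> search_inv (kill_bwd st).
Proof. by case=> If Ib It; split=> //=; apply: side_kill Ib. Qed.

Lemma kill_fwd_inv st :
  search_inv st -> search_inv (kill_fwd st).
Proof. by case=> If Ib It; split=> //=; apply: side_kill If. Qed.

Lemma update_fwd_inv st st' :
  search_inv st -> update_fwd st st' -> search_inv st'.
Proof.
move=> I [//|A0 _|s /eqP A0 sP]; first exact: kill_bwd_inv.
case: I => If Ib It; split=> /=.
- apply: (side_next A0 _ If); apply/setP=> x; rewrite !inE /=.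
  by rewrite -leNgt.
- exact: side_kill Ib.
- by rewrite inE (subsetP (side_pass If)).
Qed.

Lemma update_bwd_inv st st' :
  search_inv st -> update_bwd st st' -> search_inv st'.
Proof.
move=> I [//|A0 _|s /eqP A0 sP]; first exact: kill_fwd_inv.
case: I => If Ib It; split=> /=.
- exact: side_kill If.
- apply: (side_next A0 _ Ib); apply/setP=> x; rewrite !inE /=.
  by rewrite -leNgt.
- by rewrite inE (subsetP (side_pass Ib)) ?orbT.
Qed.

Lemma branch_inv st u z st' :
  search_inv st -> u \in fwdA st -> z \in bwdA st ->
  branch outl inl st u z (Continue st') -> search_inv st'.
Proof.
move=> I uA zA br.
inversion_clear br as [? _ step|_]; last exact: make_passive_inv.
inversion_clear step as [| |x y ro ri eo ei _ _].
exact/add_bwd_inv/add_fwd_inv/(advance_inv I uA zA eo ei).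
Qed.

Lemma iteration_inv st u z st' :
  search_inv st -> iteration outl inl st u z (Continue st') -> search_inv st'.
Proof.
move=> I [uA zA [o' br up]].
inversion up as [|st0 st1 st2 uf ub]; subst.
exact: update_bwd_inv (update_fwd_inv (branch_inv I uA zA br) uf) ub.
Qed.

(** * The potential and its decrease *)

(* Every later threshold is one of these vertices. *)
Definition candidates (st : state V) : {set V} :=
  (~: (fwd st :|: bwd st)
     :|: (fwdA st :|: fwdP st :|: (bwdA st :|: bwdP st))) :\ thr st.

(* The vertices that can still become passive before the threshold changes. *)
Definition waiting (st : state V) : {set V} :=
  ~: (thr st |: (fwdP st :|: bwdP st)).

(** A vertex outside F counts with its full list, so adding it to F leaves the sum unchanged. *)
Definition arcs_left (st : state V) : nat :=
  \sum_(x : V) size (if x \in fwd st then outp st x else outl x).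

(** The weight [#|V|] lets one lost candidate pay for refilling [waiting] when the threshold
    changes. *)
Definition potential (st : state V) : nat :=
  arcs_left st + #|V| * #|candidates st| + #|waiting st|.

Definition halted (st : state V) : bool :=
  (fwdA st == set0) || (bwdA st == set0).

Lemma waiting_lt st : #|waiting st| < #|V|.
Proof.
rewrite -cardsT; apply: proper_card; rewrite properT; apply/eqP=> /setP/(_ (thr st)).
by rewrite !inE eqxx.
Qed.

Lemma new_threshold_potential st st' :
  arcs_left st' = arcs_left st -> thr st' \in candidates st ->
  candidates st' \subset candidates st :\ thr st' ->
  potential st' <= potential st.
Proof.
move=> eq_arcs sC /subset_leq_card le_C.
rewrite /potential eq_arcs -!addnA leq_add2l.
rewrite (cardsD1 (thr st') (candidates st)) sC mulnDr muln1.
rewrite [#|V| + _]addnC -addnA leq_add ?leq_mul2l ?le_C ?orbT //.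
exact: leq_trans (ltnW (waiting_lt _)) (leq_addr _ _).
Qed.

Lemma update_fwd_potential st st' :
  search_inv st -> update_fwd st st' ->
  fwdA st' = set0 \/ potential st' <= potential st.
Proof.
case=> If Ib It [_|/eqP A0 _|s /eqP A0 sP]; [by right | by left | right].
have lt_s : (thr st < s)%O := side_far If sP.
apply: new_threshold_potential => //=.
  by rewrite !inE /= sP (gt_eqF lt_s) !orbT.
apply/subsetP=> x; rewrite !inE /= A0 !inE orbF => /andP[-> /=].
(* The old threshold is reached, not in F_P (whose vertices lie strictly above it), removed from
   B_A, and F_A and the new B_P are empty: it is dead. *)
have [->|_] /= := eqVneq x (thr st).
  have:= It; rewrite inE => -> /=.
  have /negPf-> : thr st \notin fwdP st.
    by apply/negP=> /(side_far If) /=; rewrite ltxx.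
  by rewrite !andbF.
by case/or3P=> [->|+|->]; rewrite ?orbT //; case: (x \in fwdP st); rewrite ?andbF ?orbT.
Qed.

Lemma update_bwd_potential st st' :
  search_inv st -> update_bwd st st' ->
  bwdA st' = set0 \/ potential st' <= potential st.
Proof.
case=> If Ib It [_|/eqP A0 _|s /eqP A0 sP]; [by right | by left | right].
have lt_s : (s < thr st)%O := side_far Ib sP.
apply: new_threshold_potential => //=.
  by rewrite !inE /= sP (lt_eqF lt_s) !orbT.
apply/subsetP=> x; rewrite !inE /= A0 !inE !orbF => /andP[-> /=].
have [->|_] /= := eqVneq x (thr st).
  have:= It; rewrite inE => -> /=.
  have /negPf-> : thr st \notin bwdP st.
    by apply/negP=> /(side_far Ib) /=; rewrite ltxx.
  by rewrite !andbF.
by case/or3P=> [->|->|]; rewrite ?orbT //; case: (x \in bwdP st); rewrite ?andbF ?orbT.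
Qed.

Lemma update_potential st st' :
  search_inv st -> update (Continue st) (Continue st') ->
  halted st' \/ potential st' <= potential st.
Proof.
move=> I up; inversion_clear up as [|? st1 ? uf ub].
have [A0|le1] := update_fwd_potential I uf.
  (* The second update never adds to F_A, so an empty F_A stays empty. *)
  left; apply/orP; left; case: ub => [_|_ _|s _ _] /=; rewrite A0 ?set0D //.
have [B0|le2] := update_bwd_potential (update_fwd_inv I uf) ub.
  by left; apply/orP; right; rewrite B0.
by right; apply: leq_trans le1.
Qed.

Lemma advance_arcs_left st u z a ro ri :
  u \in fwd st -> outp st u = a :: ro ->
  (arcs_left (advance st u z ro ri)).+1 = arcs_left st.
Proof.
move=> uF eo; rewrite /arcs_left (bigD1 u) // [RHS](bigD1 u) //= uF eqxx eo /=.
rewrite addSn; congr (_ + _).+1; apply: eq_bigr => x /negPf xu.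
by rewrite xu.
Qed.

Lemma add_fwd_arcs_left st x :
  arcs_left (add_fwd outl st x) = arcs_left st.
Proof.
rewrite /add_fwd; case: ifPn => // /negPf xF.
apply: eq_bigr => y _ /=; rewrite !inE.
by case: eqP => [->|] //=; rewrite xF.
Qed.

Lemma add_bwd_arcs_left st y :
  arcs_left (add_bwd inl st y) = arcs_left st.
Proof. by rewrite /add_bwd; case: ifP. Qed.

(** One outgoing arc is consumed, [waiting] is unchanged, and [candidates] cannot grow because no
    dead vertex is revived. *)
Lemma step_potential st u z st' :
  search_inv st -> u \in fwdA st ->
  search_step outl inl st u z (Continue st') -> potential st' < potential st.
Proof.
case=> If Ib It uA step; inversion_clear step as [| |x y ro ri eo ei xB yF].
have uF := subsetP (side_act If) u uA.
set st1 := add_bwd _ _ _.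
have arcs : (arcs_left st1).+1 = arcs_left st.
  by rewrite add_bwd_arcs_left add_fwd_arcs_left (advance_arcs_left _ _ uF eo).
have thr' : thr st1 = thr st.
  by rewrite /st1 /add_bwd /add_fwd; case: ifP; case: ifP.
have wait : waiting st1 = waiting st.
  by rewrite /st1 /add_bwd /add_fwd; case: ifP; case: ifP.
have cand : candidates st1 \subset candidates st.
  have advF t : t \in fwdA (advance st u z ro ri) -> t \in fwdA st.
    by rewrite /=; case: (ro) => // /setD1P[].
  have advB t : t \in bwdA (advance st u z ro ri) -> t \in bwdA st.
    by rewrite /=; case: (ri) => // /setD1P[].
  apply/subsetP=> t; rewrite in_setD1 thr' => /andP[ts tC].
  rewrite in_setD1 ts in_setU in_setC /=.
  have [tFB|//] := boolP (t \in fwd st :|: bwd st).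
  (* The cycle tests give x outside B and y outside F, so a vertex newly added to either side was
     unreached, and differs from the reached vertex [t]. *)
  have tx : x \notin fwd st -> (t == x) = false.
    move=> xF; apply: contraTF tFB => /eqP->.
    by rewrite inE (negPf xF) (negPf xB).
  have ty : y \notin bwd st -> (t == y) = false.
    move=> yB; apply: contraTF tFB => /eqP->.
    by rewrite inE (negPf yF) (negPf yB).
  rewrite inE in tFB; move: tC; rewrite /st1 /add_bwd /add_fwd /=.
  have [xF|/tx xt] := boolP (x \in fwd st);
  have [yB|/ty yt] := boolP (y \in bwd st);
  rewrite !(in_if_live, inE) /= ?xt ?yt ?andbF ?tFB /=;
  by case/orP=> [/orP[/advF->|->]|/orP[/advB->|->]]; rewrite ?orbT.
rewrite /potential wait -arcs !addSn ltnS !leq_add //.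
by rewrite leq_mul2l subset_leq_card ?orbT.
Qed.

Lemma passive_potential st u z :
  search_inv st -> u \in fwdA st -> z \in bwdA st -> (z < u)%O ->
  potential (make_passive st u z) < potential st.
Proof.
case=> If Ib It uA zA zu.
have uP := side_disj If uA; have zP := side_disj Ib zA.
have arcs : arcs_left (make_passive st u z) = arcs_left st by [].
have cand : candidates (make_passive st u z) = candidates st.
  have moveU (A P : {set V}) (b : bool) x : x \in A ->
      (if b then A :\ x else A) :|: (if b then x |: P else P) = A :|: P.
    by move=> xA; case: b => //; rewrite setUCA setUA setD1K.
  by rewrite /candidates /= !moveU.
have wait : waiting (make_passive st u z) \proper waiting st.
  apply/properP; split.
    rewrite setCS setUS // setUSS //=; case: ifP => // _; exact: subsetUr.
  (* The vertex made passive was waiting: it was active, hence not passive on its own side, and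
     passive vertices of the other side lie across the threshold. *)
  have [su|us] := ltP (thr st) u.
    exists u; rewrite !inE /= ?su ?inE ?eqxx ?orbT // (gt_eqF su) (negPf uP) /=.
    by apply/negP=> /(side_far Ib) /=; rewrite ltNge (ltW su).
  have zs := lt_le_trans zu us.
  exists z; rewrite !inE /= ?zs ?inE ?eqxx ?orbT // (lt_eqF zs) (negPf zP) orbF /=.
  by apply/negP=> /(side_far If) /=; rewrite ltNge (ltW zs).
by rewrite /potential arcs cand ltn_add2l proper_card.
Qed.

Lemma iteration_potential st u z st' :
  search_inv st -> iteration outl inl st u z (Continue st') ->
  halted st' \/ potential st' < potential st.
Proof.
move=> I [uA zA [o' br up]].
inversion up as [|st0 st1 st2 uf ub]; subst.
have lt0 : potential st0 < potential st.
  inversion_clear br as [? _ step|zu]; first exact: step_potential step.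
  exact: passive_potential.
have [H|le'] := update_potential (branch_inv I uA zA br) up; first by left.
by right; apply: leq_ltn_trans lt0.
Qed.

(** * Progress: every choice of distinct vertices can be carried out *)

Lemma update_total o : exists o' : outcome V, update o o'.
Proof.
case: o => [st|a]; last by exists (Return a); constructor.
have [st1 uf] : exists st1, update_fwd st st1.
  have [A0|A0] := boolP (fwdA st == set0); last by exists st; constructor.
  have [P0|/set0Pn[s sP]] := boolP (fwdP st == set0).
    by exists (kill_bwd st); constructor.
  by exists (new_thr_fwd (kill_bwd st) s); constructor.
have [st2 ub] : exists st2, update_bwd st1 st2.
  have [A0|A0] := boolP (bwdA st1 == set0); last by exists st1; constructor.
  have [P0|/set0Pn[s sP]] := boolP (bwdP st1 == set0).
    by exists (kill_fwd st1); constructor.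
  by exists (new_thr_bwd (kill_fwd st1) s); constructor.
by exists (Continue st2); apply: Update_continue uf ub.
Qed.

(** Active vertices have non-null pointers, and the key invariant forces the arcs pointed to into
    the shapes (u, x) and (y, z) that the step rules demand. *)
Lemma branch_total st u z :
  search_inv st -> u \in fwdA st -> z \in bwdA st -> u != z ->
  exists o, branch outl inl st u z o.
Proof.
case=> If Ib It uA zA; rewrite neq_lt => /orP[uz|zu]; last first.
  by eexists; apply: Branch_gt.
have: outp st u != [::] by apply: (side_live If); rewrite inE uA.
have: inp st z != [::] by apply: (side_live Ib); rewrite inE zA.
case ei: (inp st z) => [//|[y z'] ri] _; case eo: (outp st u) => [//|[u' x] ro] _.
have /(side_key If) /= eu : (u', x) \in outp st u by rewrite eo mem_head.
have /(side_key Ib) /= ez : (y, z') \in inp st z by rewrite ei mem_head.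
rewrite {}eu {}ez in eo ei.
have [xB|xB] := boolP (x \in bwd st).
  by eexists; apply: Branch_lt uz _; apply: Step_return_out eo ei xB.
have [yF|yF] := boolP (y \in fwd st).
  by eexists; apply: Branch_lt uz _; apply: Step_return_in eo ei xB yF.
by eexists; apply: Branch_lt uz _; apply: Step_add eo ei xB yF.
Qed.

(** * Counting the iterations of a run *)

Lemma run_inv v w k st : run outl inl v w k (Continue st) -> search_inv st.
Proof.
move eo: (Continue st) => o r; elim: r st eo => [|k0 st0 u z o0 _ IH it] st.
  by case=> ->; apply: init_inv.
by move=> eo; apply: iteration_inv (IH _ erefl) _; rewrite eo; apply: it.
Qed.

Lemma iteration_not_halted st u z o :
  iteration outl inl st u z o -> ~~ halted st.
Proof.
by case=> uA zA _; apply/norP; split; apply/set0Pn; [exists u | exists z].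
Qed.

(** A halted state admits no further iteration, so the potential has decreased in every iteration
    except possibly the last. *)
Lemma run_potential v w k st :
  run outl inl v w k (Continue st) ->
  halted st \/ k + potential st <= potential (init outl inl v w).
Proof.
move eo: (Continue st) => o r; elim: r st eo => [|k0 st0 u z o0 r IH it] st.
  by case=> ->; right.
move=> eo; rewrite -eo in it.
have [H|le0] := IH _ erefl; first by have := iteration_not_halted it; rewrite H.
have [H|lt] := iteration_potential (run_inv r) it; [by left | right].
by rewrite addSnnS (leq_trans _ le0) // leq_add2l.
Qed.

(** The extra one is for a last iteration that returns a cycle or halts the search; the potential
    bound is applied to the state before it. *)
Lemma run_bound v w k o :
  run outl inl v w k o -> k <= (potential (init outl inl v w)).+1.
Proof.
case=> // k0 st u z o0 r it.
have [H|le0] := run_potential r; first by have := iteration_not_halted it; rewrite H.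
by rewrite ltnS (leq_trans (leq_addr _ _) le0).
Qed.

Lemma init_potential v w :
  potential (init outl inl v w) < \sum_x size (outl x) + #|V| * #|V|.
Proof.
have arcs : arcs_left (init outl inl v w) = \sum_x size (outl x).
  by apply: eq_bigr => x _ /=; rewrite inE; case: (x =P w) => [->|].
rewrite /potential arcs -addnA -addnS leq_add2l.
set st := init _ _ _ _.
have lt_C : #|candidates st| < #|V|.
  rewrite -cardsT; apply: proper_card; rewrite properT; apply/eqP=> /setP/(_ v).
  by rewrite !inE eqxx.
have lt_W := waiting_lt st.
(* With n vertices, both cardinals are at most n - 1 since each set omits the threshold, and n(n -
   1) + (n - 1) < n^2. The strict inequality absorbs the extra one of [run_bound]. *)
apply: (@leq_trans (#|V| * #|candidates st| + #|V|)); first by rewrite ltn_add2l.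
by rewrite -mulnSr leq_mul2l lt_C orbT.
Qed.

End Potential.

(** The arcs are partitioned by their tails. *)
Lemma sum_out_lists (V : finType) (G : {set V * V}) outl :
  out_lists G outl -> \sum_(x : V) size (outl x) = #|G|.
Proof.
move=> outG; rewrite -sum1_card (partition_big fst predT) //=.
apply: eq_bigr => x _; have [uniq_x mem_x] := outG x.
rewrite sum1_card -(card_uniqP uniq_x); apply: eq_card => a.
by rewrite mem_x inE.
Qed.

(* G is the graph whose arc lists are scanned; G :\ (v, w) is the graph before
   the addition of (v, w), whether or not (v, w) is already on the lists.
   The second conjunct: a search that has not terminated is never blocked;
   any choice of distinct u and z can be carried out. *)
Theorem theorem4p1 (d : Order.disp_t) (V : finOrderType d) (G : {set V * V})
    (outl inl : V -> seq (V * V)) (v w : V)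
    (topG : topological (G :\ (v, w)))
    (lt_wv : (w < v)%O)
    (outG : out_lists G outl)
    (inG : in_lists G inl) :
  (forall (k : nat) (o : outcome V),
     run outl inl v w k o -> k <= #|V| ^ 2 + #|G| + #|V|) /\
  (forall (k : nat) (st : state V) (u z : V),
     run outl inl v w k (Continue st) ->
     u \in fwdA st -> z \in bwdA st -> u != z ->
     exists o : outcome V, iteration outl inl st u z o).

Proof.
have key_outl x a : a \in outl x -> a.1 = x.
  by have [_ ->] := outG x; rewrite inE => /andP[_ /eqP].
have key_inl x a : a \in inl x -> a.2 = x.
  by have [_ ->] := inG x; rewrite inE => /andP[_ /eqP].
split=> [k o r|k st u z r uA zA uz].
  apply: leq_trans (run_bound key_outl key_inl r) _.
  apply: leq_trans (init_potential outl inl v w) _.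
  (* The potential already yields n^2 + m; the last summand n is slack. *)
  by rewrite (sum_out_lists outG) -mulnn [#|G| + _]addnC leq_addr.
have [o' br] := branch_total outl inl (run_inv key_outl key_inl r) uA zA uz.
by have [o up] := update_total o'; exists o; split=> //; exists o'.
Qed.
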